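(* For all integers $n\geq 1$, $m\geq 2$ and $1\leq r\leq m$, the maximum forcing number of the quadriculated torus $T(2n,2m,2r-1)$ is $$F(T(2n,2m,2r-1))=mn.$$
   Context: Quadriculated torus: for integers $p\ge 2$, $q\ge 3$ and $1\le s\le q$, the quadriculated torus $T(p,q,s)$ is the graph obtained from a $p\times q$ chessboard ($p$ rows, each consisting of $q$ squares) by sticking the left and right sides together and then identifying the top and bottom sides with a torsion of $s$ squares. Explicitly, $T(p,q,s)$ is the simple graph with vertex set $\{v_{i,j} : i\in\{0,\dots,p-1\},\ j\in \mathbb{Z}/q\mathbb{Z}\}$, whose edges are: $v_{i,j}v_{i,j+1}$ for all $i,j$ (second index modulo $q$); $v_{i,j}v_{i+1,j}$ for $0\le i\le p-2$ and all $j$; and $v_{0,j}v_{p-1,j-s}$ for all $j$ (second index modulo $q$). Forcing numbers: let $G$ be a finite graph with a perfect matching $M$. A subset $S\subseteq M$ is a forcing set of $M$ if $S$ is contained in no perfect matching of $G$ other than $M$. The forcing number $f(G,M)$ is the smallest cardinality of a forcing set of $M$. The maximum forcing number $F(G)$ is the maximum of $f(G,M)$ over all perfect matchings $M$ of $G$. *)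

(* Defs.v *)
From mathcomp Require Import all_boot.

Set Implicit Arguments.
Unset Strict Implicit.
Unset Printing Implicit Defensive.

(* A finite simple graph is given by its adjacency relation e : rel V on a
   finite vertex type V, with e symmetric and irreflexive; its edges are
   two-element vertex sets. *)
Section Matchings.

Variables (V : finType) (e : rel V).

Definition edges : {set {set V}} := [set [set u; v] | u in V, v in e u].

Definition perfect_matching (M : {set {set V}}) : bool :=
  (M \subset edges) && partition M [set: V].

Definition forcing_set (M S : {set {set V}}) : bool :=
  (S \subset M) &&
  [forall M' : {set {set V}},
     perfect_matching M' && (S \subset M') ==> (M' == M)].

(* The minimum is only meaningful when M is a perfect matching: the default
   candidate M is then a forcing set of itself (forcing_set_refl below). *)
Definition forcing_number (M : {set {set V}}) : nat :=
  #|[arg min_(S < M | forcing_set M S) #|S|]|.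

Definition max_forcing_number : nat :=
  \max_(M : {set {set V}} | perfect_matching M) forcing_number M.

Lemma forcing_set_refl (M : {set {set V}}) :
  perfect_matching M -> forcing_set M M.
Proof.
case/andP=> _ /and3P[/eqP covM _ _]; rewrite /forcing_set subxx /=.
apply/forallP=> M'; apply/implyP=> /andP[/andP[_ /and3P[_ tM' nM']] sMM'].
rewrite eq_sym eqEsubset sMM' /=; apply/subsetP=> B BM'.
have /set0Pn[x xB] : B != set0 by apply: contraNneq nM' => <-.
have : x \in cover M by rewrite covM inE.
case/bigcupP=> C CM xC.
by rewrite -(def_pblock tM' BM' xB) (def_pblock tM' (subsetP sMM' _ CM) xC).
Qed.

Lemma forcing_numberP (M : {set {set V}}) : perfect_matching M ->
  (exists2 S, forcing_set M S & #|S| = forcing_number M) /\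
  (forall S, forcing_set M S -> forcing_number M <= #|S|).
Proof.
move=> pM; rewrite /forcing_number.
case: arg_minnP => [|S fS minS]; first exact: forcing_set_refl.
by split=> //; exists S.
Qed.

End Matchings.

Section QuadriculatedTorus.

Variables p q s : nat.

(* The pair (i, j) is the vertex v_{i,j}; each edge of the torus is listed in
   one direction, and the congruence u.2 = v.2 + s mod q encodes
   v.2 = u.2 - s without truncated subtraction. *)
Definition torus_arc (u v : 'I_p * 'I_q) : bool :=
  [|| (v.1 == u.1) && (v.2 == u.2.+1 %[mod q]),
      (v.1 == u.1.+1 :> nat) && (v.2 == u.2)
    | [&& u.1 == 0 :> nat, v.1 == p.-1 :> nat & u.2 == v.2 + s %[mod q]]].

Definition torus : rel ('I_p * 'I_q) :=
  fun u v => torus_arc u v || torus_arc v u.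

Lemma torus_sym : symmetric torus.
Proof. by move=> u v; rewrite /torus orbC. Qed.

Lemma torus_irrefl : 1 < p -> 1 < q -> irreflexive torus.
Proof.
move=> p_gt1 q_gt1 [i j]; rewrite /torus orbb /torus_arc /= eqxx /=.
rewrite -addn1 -{1}[j : nat]addn0 eqn_modDl mod0n modn_small //=.
rewrite ltn_eqF //=; case: eqP => //= ->.
by case: p p_gt1 => [|[]].
Qed.

End QuadriculatedTorus.

Arguments torus : clear implicits.

(* Main.v *)
Require Import Defs.
From mathcomp Require Import all_boot all_order ssralg ssrnum ssrint intdiv zify.

(* Each of the m n blocks of 2 x 2 vertices spans an alternating square of the
   perfect matching
     by the edges v_{i,2j} v_{i,2j+1}, so every forcing set has at
   least m n edges.

   Conversely, let X be a set of m n independent vertices.  The edges of M that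
   avoid X form a forcing set of 2 m n
     - m n edges unless some nonempty A in X is
   such that every t in A has another t' in A adjacent to the partner of t.  Up
   to translation, X consists of the even columns other than column 0 in the
     even
   rows, and of column 0 in the odd rows.  Lifting M to the square lattice and
   writing d(t) for the vector from t to its partner, one finds t' = t + 2 d(t)
   except when t or t' is the vertex z of X in the last row.  The exceptions
   disappear, after removing z from A if necessary, when z is matched along
   column 0 away from the seam, and when M is horizontal and the two rows at the
   seam are not aligned.  A translation achieves one of the two: if M is
   horizontal, some consecutive rows are not aligned because the torsion is odd.

   Finally no finite set of lattice points can be closed under t -> t + 2 d(t):
   the points of the complementary parity enclosed by a cycle of this map again
   form such a set, of smaller height. *)

Set Implicit Arguments.
Unset Strict Implicit.
Unset Printing Implicit Defensive.

Import Order.TTheory GRing.Theory Num.Theory.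

(** * Perfect matchings as involutions *)

Section Mates.

Variables (V : finType) (e : rel V).
Hypotheses (e_sym : symmetric e) (e_irr : irreflexive e).

Definition mate_matching (mu : V -> V) : {set {set V}} :=
  [set [set v; mu v] | v : V].

Definition is_mate (mu : V -> V) : Prop :=
  involutive mu /\ forall v, e v (mu v).

Lemma is_mate_neq mu v : is_mate mu -> mu v != v.
Proof. by case=> _ /(_ v); apply: contraTneq => ->; rewrite e_irr. Qed.

Lemma perfect_mate_matching mu :
  is_mate mu -> perfect_matching e (mate_matching mu).
Proof.
move=> mateP; have [muK muE] := mateP; apply/andP; split.
  apply/subsetP=> _ /imsetP[v _ ->].
  apply: imset2_f => //; exact: muE.
apply/and3P; split.
- apply/eqP/setP=> v; rewrite inE; apply/bigcupP; exists [set v; mu v].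
    exact: imset_f.
  by rewrite !inE eqxx.
- apply/trivIsetP=> _ _ /imsetP[u _ ->] /imsetP[v _ ->].
  apply: contraNT => /pred0Pn[w] /=; rewrite !inE.
  case/andP=> /orP[] /eqP -> /orP[] /eqP.
  + by move=> ->.
  + by move=> ->; rewrite muK setUC.
  + by move=> <-; rewrite muK setUC.
  + by move=> /(can_inj muK) ->.
by apply/imsetP=> -[v _ /setP/(_ v)]; rewrite !inE eqxx.
Qed.

Lemma perfect_matching_mate M : perfect_matching e M ->
  exists2 mu, is_mate mu & M = mate_matching mu.
Proof.
case/andP=> sME pM; have [covM trivM M0] := and3P pM.
pose mu v := odflt v [pick u in pblock M v :\ v].
have cov v : v \in cover M by rewrite (eqP covM) inE.
have muP v : pblock M v = [set v; mu v] /\ e v (mu v).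
  have /imset2P[u w _ uw blk] := subsetP sME _ (pblock_mem (cov v)).
  have vblk : v \in pblock M v by rewrite mem_pblock.
  have uw' : e u w by exact: uw.
  have neq : u != w by apply: contraTneq uw' => ->; rewrite e_irr.
  rewrite /mu; case: pickP => [x|no] /=.
    rewrite blk !inE in vblk *.
    case/orP: vblk neq uw' => /eqP -> neq uw' /andP[xv /orP[] /eqP ex].
    - by rewrite ex eqxx in xv.
    - by rewrite ex.
    - by rewrite ex setUC e_sym.
    - by rewrite ex eqxx in xv.
  rewrite blk !inE in vblk; case/orP: vblk neq => /eqP ev neq.
    by move: (no w); rewrite blk ev !inE eqxx orbT andbT eq_sym neq.
  by move: (no u); rewrite blk ev !inE eqxx neq.
have muK : involutive mu.
  move=> v; have [b1 e1] := muP v; have [b2 e2] := muP (mu v).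
  have eqb : pblock M (mu v) = pblock M v.
    by apply: same_pblock => //; rewrite b1 !inE eqxx orbT.
  have := set21 v (mu v); rewrite -b1 -eqb b2 !inE => /orP[] /eqP //.
  by move=> ev; move: e1; rewrite -ev e_irr.
exists mu; first by split=> // v; have [] := muP v.
apply/setP=> B; apply/idP/imsetP => [BM|[v _ ->]]; last first.
  by have [<- _] := muP v; exact: pblock_mem.
have /set0Pn[v vB] : B != set0 by apply: contraNneq M0 => <-.
by exists v => //; have [<- _] := muP v; rewrite (def_pblock trivM BM vB).
Qed.

Lemma mem_mate_matching mu mu' v : is_mate mu -> is_mate mu' ->
  ([set v; mu v] \in mate_matching mu') = (mu' v == mu v).
Proof.
move=> mP mP'; have muV := is_mate_neq v mP; have [mu'K _] := mP'.
apply/idP/eqP => [/imsetP[u _ eq]|<-]; last exact: imset_f.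
have : v \in [set u; mu' u] by rewrite -eq set21.
have : mu v \in [set u; mu' u] by rewrite -eq set22.
rewrite !inE => /orP[] /eqP e1 /orP[] /eqP e2.
- by rewrite e1 e2 eqxx in muV.
- by rewrite {1}e2 mu'K e1.
- by rewrite e1 -e2.
- by rewrite e1 e2 eqxx in muV.
Qed.

Lemma card_perfect_matching M : perfect_matching e M -> (#|M| * 2 = #|V|)%N.
Proof.
case/andP=> sME pM; rewrite -cardsT; apply/esym.
apply: (card_uniform_partition (n := 2)) pM => B BM.
have /imset2P[u w _ uw ->] := subsetP sME _ BM.
have uw' : e u w by exact: uw.
by rewrite cards2 (contraTneq _ uw') // => ->; rewrite e_irr.
Qed.

(* If two perfect matchings agree on every edge of [mate_matching mu] missing
   [X], then following an edge of the first and an edge of the second permutes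
   the vertices of [X] where they differ. *)
Lemma forcing_number_independent mu (X : {set V}) :
    is_mate mu ->
    {in X &, forall u v, ~~ e u v} ->
    (forall A : {set V}, A \subset X -> A != set0 ->
       ~ {in A, forall t, exists2 t', t' \in A & (t' != t) && e (mu t) t'}) ->
  forcing_number e (mate_matching mu) + #|X| <= #|mate_matching mu|.
Proof.
move=> mP Xind noA; have [muK muE] := mP; set M := mate_matching mu.
have pM : perfect_matching e M by exact: perfect_mate_matching.
have MM v : [set v; mu v] \in M by exact: imset_f.
(* Since [X] is independent, its vertices lie on distinct edges of [M], so exactly [#|X|] edges are
   left out of [S]. *)
pose S := [set B in M | [disjoint B & X]].
have cardX : #|M :\: S| = #|X|.
  have -> : M :\: S = [set [set v; mu v] | v in X].
    apply/setP=> B; rewrite !inE; apply/andP/imsetP=> [[nB BM]|[v vX ->]].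
      case/imsetP: BM nB => v _ ->; rewrite MM andTb.
      case/pred0Pn=> x /andP[]; rewrite !inE => /orP[] /eqP -> xX.
        by exists v.
      by exists (mu v) => //; rewrite muK setUC.
    rewrite MM andTb; split=> //.
    by apply/pred0Pn; exists v; rewrite /= !inE eqxx.
  apply: card_in_imset => u v uX vX /setP/(_ u).
  rewrite !inE eqxx /= => /esym/orP[/eqP //|/eqP ev].
  by move: (Xind v u vX uX); rewrite ev muE.
have fS : forcing_set e M S.
  apply/andP; split; first by apply/subsetP=> B; rewrite inE => /andP[].
  apply/forallP=> M'; apply/implyP=> /andP[pM' sSM'].
  have [mu' mP' eM'] := perfect_matching_mate pM'; rewrite {pM'}eM' in sSM' *.
  have [mu'K mu'E] := mP'.
  suff same v : mu' v = mu v.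
    by apply/eqP/eq_imset => v; rewrite same.
  apply/eqP; apply: contraT => vD.
  pose D := [set v | mu' v != mu v].
  have DX u : u \in D -> (u \in X) || (mu u \in X).
    rewrite inE => uD; apply: contraR uD; rewrite negb_or => /andP[uX muX].
    rewrite -(mem_mate_matching _ mP mP'); apply: (subsetP sSM').
    rewrite inE MM disjoints_subset; apply/subsetP=> x.
    by rewrite !inE => /orP[] /eqP ->.
  have muD u : u \in D -> mu u \in D.
    by rewrite !inE muK; apply: contraNneq => h; rewrite -{1}h mu'K.
  have mu'D u : u \in D -> mu' u \in D.
    by rewrite !inE mu'K; apply: contraNneq => h; rewrite {2}h muK.
  pose A := D :&: X.
  have muX u : u \in X -> mu u \notin X.
    by move=> uX; apply: contraTN (muE u) => /(Xind _ _ uX).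
  have mu'X u : u \in X -> mu' u \notin X.
    by move=> uX; apply: contraTN (mu'E u) => /(Xind _ _ uX).
  have DA : D :\: X = mu @: A.
    apply/setP=> u; apply/setDP/imsetP=> [[uD uX]|[w /setIP[wD wX] ->]].
      exists (mu u); rewrite ?muK // inE muD //.
      by move: (DX _ uD); rewrite (negbTE uX).
    by rewrite muD ?muX.
  (* [mu'] maps [A] injectively into [D :\: X], which is [mu @: A] and has as many elements as [A],
     so the two images coincide. *)
  have DA' : mu' @: A = mu @: A.
    apply/eqP; rewrite eqEcard !card_imset ?leqnn ?andbT;
      [|exact: inv_inj|exact: inv_inj].
    rewrite -DA; apply/subsetP=> _ /imsetP[w /setIP[wD wX] ->].
    by rewrite inE mu'D ?mu'X.
  exfalso; apply: (noA A); first exact: subsetIr.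
    have vD' : v \in D by rewrite inE.
    case/orP: (DX _ vD') => vX; apply/set0Pn.
      by exists v; rewrite inE vD'.
    by exists (mu v); rewrite inE muD.
  move=> t tA; have : mu t \in mu' @: A by rewrite DA' imset_f.
  case/imsetP=> w wA ew; exists w => //.
  rewrite ew e_sym mu'E andbT; apply: contraTneq tA => ewt.
  by rewrite !inE -{1}ewt -ew eqxx.
have [_ /(_ S fS) le] := forcing_numberP pM.
rewrite -cardX addnC -leq_subRL; last by rewrite subset_leq_card // subsetDl.
apply: (leq_trans le); rewrite cardsD.
rewrite (setIidPr _); last by apply/subsetP=> B; rewrite inE => /andP[].
by rewrite subKn // subset_leq_card //; apply/subsetP=> B;
  rewrite inE => /andP[].
Qed.

(** The map [c] sorts the edges of [mu] into classes, and [nu t] departs from [mu] only within class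
    [t]. A forcing set without edges of class [t] would also lie in the matching of [nu t], so it
    meets every class. *)
Lemma leq_forcing_number (T : finType) (c : V -> T) mu (nu : T -> V -> V) :
    is_mate mu -> (forall v, c (mu v) = c v) ->
    (forall t, is_mate (nu t)) ->
    (forall t v, c v != t -> nu t v = mu v) ->
    (forall t, exists v, nu t v != mu v) ->
  #|T| <= forcing_number e (mate_matching mu).
Proof.
move=> mP cmu nuP nu_mu neq.
have [[S /andP[sSM fS] <-] _] := forcing_numberP (perfect_mate_matching mP).
pose k (B : {set V}) := omap c [pick v in B].
have hit t : exists2 B, B \in S & k B == Some t.
  apply/exists_inP; apply: contraT; rewrite negb_exists_in => /forall_inP miss.
  have sub : S \subset mate_matching (nu t).
    apply/subsetP=> B BS; have /imsetP[v _ eB] := subsetP sSM _ BS.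
    have := miss _ BS; rewrite /k eB; case: pickP => [w|/(_ v)]; last first.
      by rewrite !inE eqxx.
    rewrite !inE /= => /orP wv neqt; have {wv neqt} : c v != t.
      by apply: contraNneq neqt; case: wv => /eqP ->; rewrite ?cmu => ->.
    by move/nu_mu <-; exact: imset_f.
  have /eqP eM : mate_matching (nu t) == mate_matching mu.
    apply: (implyP (forallP fS _)).
    by rewrite sub perfect_mate_matching.
  have [v] := neq t; rewrite eq_sym -(mem_mate_matching v (nuP t) mP) -eM.
  by case/negP; exact: imset_f.
rewrite -(card_imset T (@Some_inj _)); apply: leq_trans (leq_imset_card k S).
apply/subset_leq_card/subsetP=> _ /imsetP[t _ ->].
by have [B BS /eqP <-] := hit t; exact: imset_f.
Qed.

End Mates.

(** * Disjoint alternating squares *)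

Section LowerBound.

Definition flip j := if odd j then j.-1 else j.+1.

Lemma flipK : involutive flip.
Proof. by rewrite /flip => j; case o: (odd j) => /=;
  [case: j o => //= j /negbTE -> | rewrite o]. Qed.

Lemma flip_half j : (flip j)./2 = j./2.
Proof. by rewrite /flip; case o: (odd j); lia. Qed.

Lemma flip_lt n j : j < 2 * n -> flip j < 2 * n.
Proof. by rewrite /flip; case: ifP; lia. Qed.

Lemma half_lt n (j : 'I_(2 * n)) : j./2 < n.
Proof. by have := ltn_ord j; lia. Qed.

Definition oflip n (j : 'I_(2 * n)) : 'I_(2 * n) :=
  Ordinal (flip_lt (ltn_ord j)).

Lemma oflipK n : involutive (@oflip n).
Proof. by move=> j; apply: val_inj; exact: flipK. Qed.

Variables n m s : nat.
Let V := ('I_(2 * n) * 'I_(2 * m))%type.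

Definition cell (v : V) : 'I_n * 'I_m :=
  (Ordinal (half_lt v.1), Ordinal (half_lt v.2)).

Definition flip_row (v : V) : V := (v.1, oflip v.2).

(** The row matching after switching the alternating square of block [t]: its two horizontal edges
    become vertical. *)
Definition flip_cell (t : 'I_n * 'I_m) (v : V) : V :=
  if cell v == t then (oflip v.1, v.2) else flip_row v.

Lemma torus_row_flip (v : V) : torus (2 * n) (2 * m) s v (flip_row v).
Proof.
case: v => i j; rewrite /torus /torus_arc /flip_row /= !eqxx /= /flip.
case: ifP => oj; apply/orP; [right|left]; rewrite ?eqxx //.
by rewrite prednK ?eqxx //; case: (j : nat) oj.
Qed.

Lemma torus_col_flip (v : V) : torus (2 * n) (2 * m) s v (oflip v.1, v.2).
Proof.
case: v => i j; rewrite /torus /torus_arc /= !eqxx /= !andbT /flip.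
case: ifP => oi; apply/orP; [right|left]; rewrite ?eqxx ?orbT //.
by rewrite prednK ?eqxx ?orbT //; case: (i : nat) oi.
Qed.

Lemma cell_flip_row v : cell (flip_row v) = cell v.
Proof. by congr (_, _); apply: val_inj; rewrite //= flip_half. Qed.

Lemma cell_flip_col v : cell (oflip v.1, v.2) = cell v.
Proof. by congr (_, _); apply: val_inj; rewrite //= flip_half. Qed.

Lemma torus_max_forcing_ge : 0 < n -> 1 < m ->
  m * n <= max_forcing_number (torus (2 * n) (2 * m) s).
Proof.
move=> n0 m1.
have e_irr : irreflexive (torus (2 * n) (2 * m) s) by apply: torus_irrefl; lia.
have e_sym := @torus_sym (2 * n) (2 * m) s.
have rP : is_mate (torus (2 * n) (2 * m) s) flip_row.
  split; last exact: torus_row_flip.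
  by move=> [i j]; rewrite /flip_row /= oflipK.
have cP t : is_mate (torus (2 * n) (2 * m) s) (flip_cell t).
  split=> v; last first.
    rewrite /flip_cell; case: ifP => _;
      [exact: torus_col_flip | exact: torus_row_flip].
  rewrite {2}/flip_cell; case: ifP => vt.
    by rewrite /flip_cell cell_flip_col vt /= oflipK; case: (v).
  by rewrite /flip_cell cell_flip_row vt (proj1 rP).
rewrite /max_forcing_number.
have := perfect_mate_matching rP.
move/(@leq_bigmax_cond _ _ (forcing_number (torus (2 * n) (2 * m) s))).
apply: leq_trans.
have -> : m * n = #|{: 'I_n * 'I_m}| by rewrite card_prod !card_ord mulnC.
apply: (leq_forcing_number e_irr rP cell_flip_row cP) => [t v|[a b]].
  by rewrite /flip_cell => /negbTE ->.
have la : 2 * a < 2 * n by rewrite ltn_pmul2l.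
have lb : 2 * b < 2 * m by rewrite ltn_pmul2l.
exists (Ordinal la, Ordinal lb); rewrite /flip_cell.
have -> : cell (Ordinal la, Ordinal lb) == (a, b).
  by apply/eqP; congr (_, _); apply: val_inj; rewrite /= mul2n doubleK.
by apply/eqP => -[]; rewrite /flip; case: ifP; lia.
Qed.

End LowerBound.


(** * Perfect matchings of the square lattice *)

Local Open Scope ring_scope.

Lemma eq_mod2P (u x : int) : (u = x %[mod 2])%Z -> exists k, u = x + k + k.
Proof. by move=> ux; exists ((u - x) %/ 2)%Z; lia. Qed.

Definition unit_step (a b : int) : Prop :=
  (a = 0 /\ (b = 1 \/ b = -1)) \/ (b = 0 /\ (a = 1 \/ a = -1)).

(** A minimal nonempty subset stable under [f] equals its image, since the image is stable too;
    being finite, it is permuted by [f]. *)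
Lemma periodic_core (T : choiceType) (f : T -> T) (A : seq T) :
    A != [::] -> {in A, forall p, f p \in A} ->
  exists B : seq T,
    [/\ B != [::], uniq B, {subset B <= A} & perm_eq (map f B) B].
Proof.
move=> A0 clA.
pose good (B : {set seq_sub A}) :=
  (B != set0) && [forall p in B, [exists q in B, val q == f (val p)]].
have goodT : exists B, good B.
  exists setT; apply/andP; split.
    case: A A0 {clA good} => // a A _; apply/set0Pn.
    by exists (SeqSub (mem_head a A)).
  apply/forall_inP=> p _; apply/exists_inP.
  by exists (SeqSub (clA _ (valP p))).
have [B /minsetP[/andP[B0 /forall_inP clB] minB]] := ex_minset goodT.
pose g (p : seq_sub A) : seq_sub A := SeqSub (clA _ (valP p)).
have gB p : p \in B -> g p \in B.
  by move/clB/exists_inP=> [q qB /eqP eq]; rewrite (_ : g p = q) //;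
    apply: val_inj.
have gBB : g @: B = B.
  apply: minB; last by apply/subsetP=> _ /imsetP[p pB ->]; exact: gB.
  apply/andP; split.
    by case/set0Pn: B0 => p pB; apply/set0Pn; exists (g p); exact: imset_f.
  apply/forall_inP=> _ /imsetP[p pB ->]; apply/exists_inP.
  by exists (g (g p)) => //; apply: imset_f; exact: gB.
have injg : {in B &, injective g} by apply/imset_injP; rewrite gBB.
exists [seq val p | p <- enum B]; split.
- case/set0Pn: B0 => p; rewrite -mem_enum.
  by case: (enum B).
- by rewrite map_inj_uniq ?enum_uniq //; exact: val_inj.
- by move=> _ /mapP[p _ ->]; exact: (valP p).
rewrite -map_comp (eq_map (g := val \o g)) // map_comp perm_map //.
apply: uniq_perm; rewrite ?enum_uniq //.
  rewrite map_inj_in_uniq ?enum_uniq //.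
  by move=> p q; rewrite !mem_enum; exact: injg.
move=> p; rewrite mem_enum -{2}gBB; apply/mapP/imsetP.
  by case=> q; rewrite mem_enum => qB ->; exists q.
by case=> q qB ->; exists q; rewrite ?mem_enum.
Qed.

(* Since [f] permutes [B], the sum of [Q p + Q (f p)] over [B] is even. *)
Lemma odd_sum_perm (T : eqType) (f : T -> T) (B : seq T) (P Q : T -> nat) :
    perm_eq (map f B) B ->
    (forall p, p \in B -> odd (P p) = odd (Q p + Q (f p))) ->
  odd (\sum_(p <- B) P p) = false.
Proof.
move=> pB PQ.
suff -> : odd (\sum_(p <- B) P p) = odd (\sum_(p <- B) (Q p + Q (f p))).
  by rewrite big_split /= -(big_map f xpredT) (perm_big _ pB) addnn odd_double.
elim: B {pB} PQ => [|p B IH] PQ; first by rewrite !big_nil.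
rewrite !big_cons oddD PQ ?mem_head // IH => [|q qB].
  by rewrite -oddD.
by apply: PQ; rewrite inE qB orbT.
Qed.

Lemma count_sum (T : Type) (P : pred T) (B : seq T) :
  count P B = (\sum_(p <- B) P p)%N.
Proof. by rewrite -sum1_count big_mkcond. Qed.

(** By parity, the midpoint of a jump from [(u, v)] lies in row [x] only if the jump is vertical,
    and its column is then congruent to [y + 1]; from [y] up to [y + 2] only [y + 1] remains. *)
Lemma left_count_right (x y u v a b : int) :
    (u = x + 1 %[mod 2])%Z -> (v = y + 1 %[mod 2])%Z -> unit_step a b ->
  odd (((u + a == x) && (v + b < y + 2))%R + ((u + a == x) && (v + b < y))%R
       + ((u + a == x) && (v + b == y + 1))%R)%N = false.
Proof.
by move=> /eq_mod2P[k ->] /eq_mod2P[l ->]; case=> -[-> [] ->]; lia.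
Qed.

(** A jump has exactly one end in row [x + 1] left of [y] precisely when its midpoint is
    [(x + 1, y)] or lies left of [y] in row [x] or [x + 2]. *)
Lemma left_count_up (x y u v a b : int) :
    (u = x + 1 %[mod 2])%Z -> (v = y + 1 %[mod 2])%Z -> unit_step a b ->
  odd (((u + a == x + 2) && (v + b < y))%R + ((u + a == x) && (v + b < y))%R
       + ((u + a == x + 1) && (v + b == y))%R)%N =
  odd (((u == x + 1) && (v < y))%R
       + ((u + 2 * a == x + 1) && (v + 2 * b < y))%R)%N.
Proof.
by move=> /eq_mod2P[k ->] /eq_mod2P[l ->]; case=> -[-> [] ->]; lia.
Qed.

Lemma row_crossing (x u a b : int) :
    (u = x + 1 %[mod 2])%Z -> unit_step a b ->
  (u + a == x) = (u < x) (+) (u + 2 * a < x).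
Proof.
by move=> /eq_mod2P[k ->]; case=> -[]; [move=> -> _|move=> _ [] ->]; lia.
Qed.

Section PlanarMatching.

Variables dx dy : int -> int -> int.
Hypothesis d_unit : forall x y, unit_step (dx x y) (dy x y).
Hypothesis d_oppx : forall x y, dx (x + dx x y) (y + dy x y) = - dx x y.
Hypothesis d_oppy : forall x y, dy (x + dx x y) (y + dy x y) = - dy x y.

Let mid (p : int * int) := (p.1 + dx p.1 p.2, p.2 + dy p.1 p.2).
Let jump (p : int * int) := (p.1 + 2 * dx p.1 p.2, p.2 + 2 * dy p.1 p.2).

Lemma mid_inj : injective mid.
Proof.
move=> [x y] [x' y']; rewrite /mid /= => -[ex ey].
move: (d_oppx x y) (d_oppy x y); rewrite ex ey d_oppx d_oppy => ex' ey'.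
by congr (_, _); lia.
Qed.

(* [B] is a union of cycles of [jump].  [S] collects the points, of the parity
   opposite to that of [A] in both coordinates, with an odd number of points of
   these cycles to their left in the same row.  A matched edge leaving [S] would
   have to use a midpoint of [B], which is already matched; hence [S] is closed
   under [jump], and it lies strictly between the extreme rows of [B]. *)
Lemma no_closed_set_box h (a b : int) w (A : seq (int * int)) (i j : int) :
    A != [::] ->
    {in A, forall p, [/\ (p.1 = i %[mod 2])%Z, (p.2 = j %[mod 2])%Z,
                         a <= p.1 < a + h%:Z & b <= p.2 < b + w%:Z]} ->
    {in A, forall p, jump p \in A} ->
  False.
Proof.
elim: h a b w A i j => [|h IH] a b w A i j A0 boxA clA.
  by case: A A0 boxA {clA} => // p A _ /(_ p (mem_head _ _)) [_ _]; lia.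
have [B [B0 uB sBA pB]] := periodic_core A0 clA.
have boxB p : p \in B -> [/\ (p.1 = i %[mod 2])%Z, (p.2 = j %[mod 2])%Z,
     a <= p.1 < a + h.+1%:Z & b <= p.2 < b + w%:Z] by move/sBA/boxA.
have jumpB p : p \in B -> jump p \in B.
  by move=> pB'; rewrite -(perm_mem pB); exact: map_f.
pose left x y (p : int * int) := ((mid p).1 == x) && ((mid p).2 < y).
pose S x y := odd (count (left x y) B).
pose z x y := (x, y) \in map mid B.
have zE x y : odd (count (fun p => mid p == (x, y)) B) = z x y.
  rewrite -(count_map mid (pred1 (x, y))) count_uniq_mem ?map_inj_uniq //.
    by rewrite oddb.
  exact: mid_inj.
have cl p : p \in B -> [/\ (p.1 = i %[mod 2])%Z, (p.2 = j %[mod 2])%Z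
    & unit_step (dx p.1 p.2) (dy p.1 p.2)].
  by move/boxB => [? ? _ _]; split.
have Sright x y : (x = i + 1 %[mod 2])%Z -> (y = j + 1 %[mod 2])%Z ->
    S x (y + 2) = S x y (+) z x (y + 1).
  move=> xi yj.
  have : odd (\sum_(p <- B) (left x (y + 2)%R p + left x y p + (mid p == (x,
    y + 1)%R))%N) = false.
    apply: (@odd_sum_perm _ jump _ _ (fun=> 0%N)) => // -[u v] /cl[/= ui vj].
    have ux : (u = x + 1 %[mod 2])%Z by clear -ui xi; lia.
    have vy : (v = y + 1 %[mod 2])%Z by clear -vj yj; lia.
    by rewrite /left /mid xpair_eqE /=; exact: left_count_right.
  rewrite 2!big_split /= -3!count_sum 2!oddD zE -/(S _ _) -/(S _ _).
  by case: (S _ _) (S _ _) (z _ _) => [] [] [].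
have Sup x y : (x = i + 1 %[mod 2])%Z -> (y = j + 1 %[mod 2])%Z ->
    S (x + 2) y = S x y (+) z (x + 1) y.
  move=> xi yj.
  have : odd (\sum_(p <- B) (left (x + 2)%R y p + left x y p + (mid p == (x +
    1, y)%R))%N) = false.
    apply: (@odd_sum_perm _ jump _ _ (fun p =>
      (p.1 == x + 1) && (p.2 < y) : nat)) => // -[u v] /cl[/= ui vj].
    have ux : (u = x + 1 %[mod 2])%Z by clear -ui xi; lia.
    have vy : (v = y + 1 %[mod 2])%Z by clear -vj yj; lia.
    by rewrite /left /mid xpair_eqE /=; exact: left_count_up.
  rewrite 2!big_split /= -3!count_sum 2!oddD zE -/(S _ _) -/(S _ _).
  by case: (S _ _) (S _ _) (z _ _) => [] [] [].
have Sbox x y : (x = i + 1 %[mod 2])%Z -> S x y ->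
    a + 1 <= x < a + 1 + h%:Z /\ b <= y < b + w%:Z + 1.
  move=> xi Sxy.
  have /hasP[p pinB /andP[/eqP mp1 mp2]] : has (left x y) B.
    by rewrite has_count lt0n; apply: contraTneq Sxy => S0; rewrite /S S0.
  (* Beyond the right end of the box, [S] counts all midpoints in row [x], that is, all crossings of
     this row by closed cycles: an even number. *)
  have ylt : y < b + w%:Z + 1.
    rewrite ltNge; apply/negP => yge; move: Sxy; rewrite /S.
    have : odd (\sum_(q <- B) left x y q)%N = false.
      apply: (odd_sum_perm (Q :=
        fun q : int * int => nat_of_bool (q.1 < x)) pB) => -[u v] qB.
      have [/= ui _ _ vb] := boxB _ qB;
        have [/= _ _ _ vb'] := boxB _ (jumpB _ qB).
      have ux : (u = x + 1 %[mod 2])%Z by clear -ui xi; lia.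
      rewrite /left /mid /= oddD !oddb (row_crossing ux (d_unit u v)).
      have -> : (v + dy u v < y) by clear -yge vb vb'; lia.
      by rewrite andbT.
    by rewrite -count_sum => ->.
  have [/= ui _ ua vb] := boxB _ pinB.
  have [/= _ _ ua' vb'] := boxB _ (jumpB _ pinB).
  have := d_unit p.1 p.2; rewrite /mid /= in mp1 mp2.
  clear -mp1 mp2 ui xi ua vb ua' vb' ylt.
  by case=> -[e [] e']; rewrite ?e ?e' in mp1 mp2 ua' vb'; split; lia.
have Snz x y : (x = i + 1 %[mod 2])%Z -> (y = j + 1 %[mod 2])%Z ->
    z (x + dx x y) (y + dy x y) = false.
  move=> xi yj; apply/negP => /mapP[p pinB e].
  have [pi pj _] := cl _ pinB.
  have /mid_inj ep : mid (x, y) = mid p by rewrite -e.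
  by rewrite -ep /= in pi pj; clear -pi xi; lia.
pose box := [seq (a + k%:Z, b + l%:Z) | k <- iota 0 h.+1, l <- iota 0 w.+1].
pose A' := [seq p <- box | [&& S p.1 p.2, (p.1 == i + 1 %[mod 2])%Z
                             & (p.2 == j + 1 %[mod 2])%Z]].
have memA' x y : ((x, y) \in A') = [&& S x y, (x == i + 1 %[mod 2])%Z
                             & (y == j + 1 %[mod 2])%Z].
  rewrite mem_filter /= andbC andb_idl // => /and3P[Sxy /eqP xi _].
  have [xa yb] := Sbox _ _ xi Sxy.
  apply/allpairsP; exists (`|x - a|%N, `|y - b|%N); rewrite !mem_iota /=.
  by clear -xa yb; split; [lia | lia | congr (_, _); lia].
apply: (IH (a + 1) b w.+1 A' (i + 1) (j + 1)).
(* [S] takes different values on the two sides of a midpoint of [B], so it holds on one of them. *)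
- have [p pinB] : exists p, p \in B.
    by case: (B) B0 => // p B' _; exists p; exact: mem_head.
  have [pi pj us] := cl _ pinB.
  have zp : z (p.1 + dx p.1 p.2) (p.2 + dy p.1 p.2) by apply: (map_f mid).
  have notnil q : q \in A' -> A' != [::] by apply: contraTneq => ->.
  case: us zp => -[-> e]; rewrite addr0.
    set y := p.2 + _ => zp.
    have yj : (y = j + 1 %[mod 2])%Z.
      by rewrite /y; clear -e pj; case: e => ->; lia.
    have xi : (p.1 - 1 = i + 1 %[mod 2])%Z by clear -pi; lia.
    have := Sup (p.1 - 1) y xi yj.
    rewrite (_ : p.1 - 1 + 1 = p.1) ?subrK // zp addbT.
    case Sxy: (S (p.1 - 1) y) => S2.
      by apply: (notnil (p.1 - 1, y)); rewrite memA' Sxy xi yj !eqxx.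
    apply: (notnil (p.1 - 1 + 2, y)); rewrite memA' S2 yj eqxx andbT.
    by clear -xi; lia.
  set x := p.1 + _ => zp.
  have xi : (x = i + 1 %[mod 2])%Z.
    by rewrite /x; clear -e pi; case: e => ->; lia.
  have yj : (p.2 - 1 = j + 1 %[mod 2])%Z by clear -pj; lia.
  have := Sright x (p.2 - 1) xi yj.
  rewrite (_ : p.2 - 1 + 1 = p.2) ?subrK // zp addbT.
  case Sxy: (S x (p.2 - 1)) => S2.
    by apply: (notnil (x, p.2 - 1)); rewrite memA' Sxy xi yj !eqxx.
  apply: (notnil (x, p.2 - 1 + 2)); rewrite memA' S2 xi eqxx.
  by clear -yj; lia.
- move=> -[x y]; rewrite memA' => /and3P[Sxy /eqP xi /eqP yj].
  have [xa yb] := Sbox _ _ xi Sxy.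
  by split; [exact: xi | exact: yj | exact: xa | clear -yb => /=; lia].
move=> -[x y]; rewrite memA' => /and3P[Sxy /eqP xi /eqP yj].
have zn := Snz _ _ xi yj.
rewrite /jump memA' -![(x, y).1]/x -![(x, y).2]/y.
case: (d_unit x y) zn => -[-> [] ->]; rewrite !(mulr0, mulr1, addr0) => zn.
- by rewrite Sright // Sxy zn xi eqxx; clear -yj; lia.
- rewrite mulrN1 xi eqxx andTb; apply/andP; split; last by clear -yj; lia.
  move: (Sright x (y - 2)); rewrite subrK Sxy (_ : y - 2 + 1 = y - 1);
    last by clear; lia.
  by rewrite zn addbF => <- //; clear -yj; lia.
- by rewrite Sup // Sxy zn yj eqxx andbT; clear -xi; lia.
rewrite mulrN1 yj eqxx andbT; apply/andP; split; last by clear -xi; lia.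
move: (Sup (x - 2) y); rewrite subrK Sxy (_ : x - 2 + 1 = x - 1);
  last by clear; lia.
by rewrite zn addbF => <- //; clear -xi; lia.
Qed.

Lemma no_closed_set (A : seq (int * int)) (i j : int) :
    A != [::] ->
    {in A, forall p, (p.1 = i %[mod 2])%Z /\ (p.2 = j %[mod 2])%Z} ->
    {in A, forall p, jump p \in A} ->
  False.
Proof.
move=> A0 clA jA.
pose N := (\max_(p <- A) maxn `|p.1| `|p.2|)%N.
apply: (@no_closed_set_box (N + N).+1 (- N%:Z) (- N%:Z) (N + N).+1 A i j) =>
  // -[x y] pA.
have [xi yj] := clA _ pA.
have : (maxn `|x| `|y| <= N)%N.
  exact: (@leq_bigmax_seq _ A xpredT (fun p => maxn `|p.1| `|p.2|)%N (x, y)).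
by clear -xi yj; clearbody N => xyN; split=> //=; clear -xyN; lia.
Qed.

End PlanarMatching.

(** * The covering of the torus by the square lattice *)

Lemma modz_absz_lt (p : nat) (x : int) : (0 < p)%N -> (`|(x %% p)%Z| < p)%N.
Proof.
move=> p0; have : (x %% p)%Z < p by rewrite ltz_pmod.
have : 0 <= (x %% p)%Z by rewrite modz_ge0 // -lt0n.
by move: (x %% p)%Z => z; lia.
Qed.

Section Lift.

Variables p q s : nat.
Hypotheses (p_gt1 : (1 < p)%N) (q_gt2 : (2 < q)%N).

Let p_gt0 : (0 < p)%N. Proof. exact: ltnW. Qed.
Let q_gt0 : (0 < q)%N. Proof. exact: ltn_trans q_gt2. Qed.

Let V := ('I_p * 'I_q)%type.

(* Crossing from row [p - 1] to row [p] of the lattice adds [s] to the column. *)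
Definition cover_torus (x y : int) : V :=
  (Ordinal (modz_absz_lt x p_gt0),
   Ordinal (modz_absz_lt (y + s%:Z * (x %/ p)%Z) q_gt0)).

Lemma cover_torusE x y : (nat_of_ord (cover_torus x y).1)%:Z = (x %% p)%Z /\
  (nat_of_ord (cover_torus x y).2)%:Z = ((y + s%:Z * (x %/ p)%Z) %% q)%Z.
Proof.
have p0 : p%:Z != 0 by lia.
have q0 : q%:Z != 0 by lia.
by split; rewrite /= gez0_abs // modz_ge0.
Qed.

(** The fibres are the cosets of the lattice spanned by [(p, - s)] and [(0, q)]. *)
Lemma eq_cover_torus x y x' y' :
  (exists k l, x' = x + k * p%:Z /\ y' = y - k * s%:Z + l * q%:Z) <->
  cover_torus x y = cover_torus x' y'.
Proof.
have p0 : p%:Z != 0 by lia.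
split=> [[k [l [-> ->]]]|eq].
  have [e1 e2] := cover_torusE x y.
  have [e1' e2'] := cover_torusE (x + k * p%:Z) (y - k * s%:Z + l * q%:Z).
  rewrite [x + _]addrC in e1' e2' *.
  rewrite modzMDl in e1'; rewrite divzMDl // in e2'.
  rewrite (_ : _ + s%:Z * _ = l * q + (y + s%:Z * (x %/ p)%Z)) ?modzMDl in
    e2'; last first.
    rewrite mulrDr [s%:Z * k]mulrC;
      move: (k * _) (l * _) (s%:Z * _) => a b c; lia.
  apply: injective_projections; apply/ord_inj/eqP; rewrite -eqz_nat.
    by rewrite e1 -e1'.
  by rewrite e2 -e2'.
have [e1 e2] := cover_torusE x y; have [e1' e2'] := cover_torusE x' y'.
exists ((x' %/ p)%Z - (x %/ p)%Z).
have : (q%:Z %| (y' + s%:Z * (x' %/ p)%Z) - (y + s%:Z * (x %/ p)%Z))%Z.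
  by rewrite -eqz_mod_dvd -e2 -e2' eq.
case/dvdzP=> l el; exists l; split.
  rewrite {1}(divz_eq x' p) {1}(divz_eq x p) -e1 -e1' eq mulrBl.
  by lia.
rewrite mulrBl ![_ * s%:Z]mulrC.
by lia.
Qed.

Lemma cover_torus_val (v : V) : cover_torus v.1 v.2 = v.
Proof.
case: v => i j; rewrite /cover_torus /=.
have ie : ((i : nat)%:Z %/ p)%Z = 0 by rewrite divz_nat divn_small.
congr (_, _); apply: val_inj;
  rewrite /= ?ie ?mulr0 ?addr0 modz_nat /= modn_small //.
Qed.

Lemma cover_torus_shift a b x y x' y' :
  cover_torus x y = cover_torus x' y' ->
    cover_torus (x + a) (y + b) = cover_torus (x' + a) (y' + b).
Proof.
move/eq_cover_torus => [k [l [-> ->]]]; apply/eq_cover_torus; exists k, l.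
by split; lia.
Qed.

Lemma cover_torus_glue x y :
  cover_torus (x + p%:Z) y = cover_torus x (y + s%:Z).
Proof. by apply/eq_cover_torus; exists (-1), 0; lia. Qed.

Lemma cover_torus_round x y l : cover_torus x (y + l * q%:Z) = cover_torus x y.
Proof. by apply/eq_cover_torus; exists 0, (- l); rewrite mulNr mul0r; lia. Qed.

Lemma torus_cover_nbr x y v : torus p q s (cover_torus x y) v ->
  exists a b, unit_step a b /\ v = cover_torus (x + a) (y + b).
Proof.
have := cover_torus_val (cover_torus x y);
  move: {1 2 4}(cover_torus x y) => u xyu uv.
suff [a [b [us ev]]] :
  exists a b, unit_step a b /\ v = cover_torus (u.1%:Z + a) (u.2%:Z + b).
  by exists a, b; split=> //; rewrite ev; exact: cover_torus_shift.
rewrite -(cover_torus_val v).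
move: u v uv {xyu} => [i j] [i' j'] /=; rewrite /torus /torus_arc /=.
have mod_eq (c d : nat) : c = d %[mod q] -> exists l, c%:Z = d%:Z + l * q%:Z.
  move=> cd; have : (q%:Z %| c%:Z - d%:Z)%Z
    by rewrite -eqz_mod_dvd !modz_nat cd.
  by case/dvdzP => l el; exists l; rewrite -el; lia.
case/orP => /or3P[].
- case/andP=> /eqP -> /eqP/mod_eq[l ->]; exists 0, 1; split; first by left; lia.
  by rewrite cover_torus_round addr0 -addn1 PoszD.
- case/andP=> /eqP -> /eqP ->; exists 1, 0; split; first by right; lia.
  by rewrite addr0 -addn1 PoszD.
- case/and3P=> /eqP -> /eqP -> /eqP/mod_eq[l el]; exists (-1), 0; split;
  first by right; lia.
  apply/eq_cover_torus; exists (-1), l; lia.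
- case/andP=> /eqP -> /eqP/mod_eq[l el]; exists 0, (-1); split;
  first by left; lia.
  apply/eq_cover_torus; exists 0, l; lia.
- case/andP=> /eqP -> /eqP ->; exists (-1), 0; split; first by right; lia.
  by rewrite addr0 -addn1 PoszD addrK.
- case/and3P=> /eqP i'0 /eqP ep /eqP/mod_eq[l el]; exists 1, 0; split;
  first by right; lia.
  apply/eq_cover_torus; exists 1, (- l); rewrite i'0 ep mulNr; lia.
Qed.

Lemma cover_torus_mate mu : is_mate (torus p q s) mu ->
  exists dx dy : int -> int -> int, forall x y,
    unit_step (dx x y) (dy x y) /\
    mu (cover_torus x y) = cover_torus (x + dx x y) (y + dy x y).
Proof.
move=> [_ muE].
(* Two booleans encode the four directions, so that [xchoose] can select one at each lattice
   point. *)
pose da (d : bool * bool) : int := if d.1 then 0 else if d.2 then 1 else -1.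
pose db (d : bool * bool) : int := if d.1 then if d.2 then 1 else -1 else 0.
have ex x y : exists d, mu (cover_torus x y) == cover_torus (x + da d) (y +
  db d).
  have [a [b [us ->]]] := torus_cover_nbr (muE (cover_torus x y)).
  case: us => -[-> []->]; [exists (true, true) | exists (true, false)
    | exists (false, true) | exists (false, false)]; exact: eqxx.
exists (fun x y => da (xchoose (ex x y))), (fun x y => db (xchoose (ex x y))).
move=> x y; split; last exact/eqP/(xchooseP (ex x y)).
by rewrite /unit_step /da /db; case: (xchoose _) => -[] [] /=; lia.
Qed.

Hypothesis s_bounds : (0 < s < q)%N.

(** Unit steps differ by at most 2 in each coordinate. A nonzero period of this size with [k = 0]
    contradicts [2 < q]; with [k <> 0] it requires [p = 2] and opposite vertical steps, and then [q]
    would divide [s], against [s_bounds]. *)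
Lemma cover_torus_nbr_inj x y a b a' b' :
    unit_step a b -> unit_step a' b' ->
  cover_torus (x + a) (y + b) = cover_torus (x + a') (y + b') ->
    a = a' /\ b = b'.
Proof.
move=> us us' /eq_cover_torus[k [l [ea eb]]].
have ab : [/\ -1 <= a <= 1, -1 <= b <= 1, a = 0 \/ b = 0 & a <> 0 \/ b <> 0].
  by case: us => -[-> []->]; split; lia.
have ab' : [/\ -1 <= a' <= 1, -1 <= b' <= 1, a' = 0 \/ b' = 0
  & a' <> 0 \/ b' <> 0].
  by case: us' => -[-> []->]; split; lia.
case: ab ab' => a1 b1 n1 m1 [a2 b2 n2 m2].
have kb : -1 <= k <= 1 by nia.
have l0 : k = 0 -> l = 0 by move=> k0; rewrite k0 in eb; nia.
have [k0|k0] : k = 0 \/ k <> 0 by lia.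
  by rewrite k0 (l0 k0) in ea eb; lia.
have bb : b = 0 /\ b' = 0 by case: (k =P 1) => [?|?]; lia.
case: bb => b0 b'0; exfalso; rewrite b0 b'0 in eb.
have lb : -1 < l < 1 by nia.
by nia.
Qed.

End Lift.

(** * Marked vertices *)

Lemma dvdz_lt_eq0 (d y : int) : (d %| y)%Z -> - d < y < d -> y = 0.
Proof.
case/dvdzP=> l -> b; have d_gt0 : 0 < d by lia.
rewrite -mulN1r -[X in _ && (_ < X)]mul1r !ltr_pM2r // in b.
have -> : l = 0 by lia.
by rewrite mul0r.
Qed.

(* What remains of the marking rule in row [u] and column [v] once divisibility of
   [v] by [q] is only used for [v] in the range [-q, q]: unlike
   divisibility, it is linear in [q]. *)
Definition mark_residue (q u v : int) : Prop :=
  ((u %% 2)%Z = 1 /\ (v %% 2)%Z = 0 /\ (- q < v < q -> v = 0)) \/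
  ((u %% 2)%Z = 0 /\ (v %% 2)%Z = 0 /\ v <> 0 /\ v <> q).

(** Marked columns are even. Away from the seam the two steps therefore cannot be one horizontal and
    one vertical, so they are equal; across the seam the odd [S] forces exactly such a turn. [D]
    abstracts a divisibility by [Q], which keeps all sixteen pairs of directions linear. *)
Lemma mark_residue_step (P Q S x y a b a' b' : int) (D : Prop) :
    (P %% 2)%Z = 0 -> (Q %% 2)%Z = 0 -> (S %% 2)%Z = 1 -> 2 <= P -> 4 <= Q ->
    0 <= x < P -> 0 <= y < Q ->
    mark_residue Q x y ->
    unit_step a b -> unit_step a' b' -> ~ (a' = - a /\ b' = - b) ->
    [\/ (0 <= x + a + a' < P) /\ mark_residue Q (x + a + a') (y + b + b'),
        (0 <= x + a + a' - P < P) /\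
           mark_residue Q (x + a + a' - P) (y + b + b' + S) |
        (0 <= x + a + a' + P < P) /\
           (mark_residue Q (x + a + a' + P) (y + b + b' - S) /\
           (((x + a + a' + P) %% 2)%Z = 1 -> D))] ->
  [\/ [/\ a' = a, b' = b, 0 <= x + 2 * a < P, 0 <= y + 2 * b < Q
        & (x %% 2)%Z = 1 -> b = 0],
      [/\ x = 0, a + a' = -1 & D] |
      x = P - 1 /\ a + a' = 1].
Proof.
rewrite /mark_residue => P2 Q2 S2 Pb Qb xb yb Fx.
move=> [] [-> []->] [] [-> []->] nopp; try (by case: nopp; split; lia).
all: case=> -[xb' F'].
all: try (by exfalso; lia).
all: try (by constructor 1; split; lia).
all: try (by constructor 3; split; lia).
all: by constructor 2; split; [lia|lia|apply: F'.2; lia].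
Qed.

Section UpperBound.

Variables n m r : nat.
Hypotheses (n_ge1 : (1 <= n)%N) (m_ge2 : (2 <= m)%N) (r_bounds :
  (1 <= r <= m)%N).

Let p := (2 * n)%N.
Let q := (2 * m)%N.
Let s := (2 * r - 1)%N.
Let V := ('I_p * 'I_q)%type.

Let p_gt1 : (1 < p)%N. Proof. by rewrite /p; lia. Qed.
Let q_gt2 : (2 < q)%N. Proof. by rewrite /q; lia. Qed.
Let s_bounds : (0 < s < q)%N. Proof. by rewrite /s /q; lia. Qed.

Let cov : int -> int -> V := @cover_torus p q s p_gt1 q_gt2.

Definition marked (v : V) : bool :=
  if odd v.1 then v.2 == 0 :> nat else ~~ odd v.2 && (v.2 != 0 :> nat).

Let chi x y := marked (cov x y).

Lemma card_marked : (m * n <= #|[set v | marked v]|)%N.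
Proof.
have lt_o (a : 'I_n) : (2 * a + 1 < p)%N by have := ltn_ord a; rewrite /p; lia.
have lt_e (a : 'I_n) : (2 * a < p)%N by have := ltn_ord a; rewrite /p; lia.
have lt_c (b : 'I_m) : (2 * b < q)%N by have := ltn_ord b; rewrite /q; lia.
(* Rows [2a] and [2a + 1] contain one marked vertex in each even column [2b]: in row [2a + 1] if
   [b = 0], in row [2a] otherwise. *)
pose f (t : 'I_n * 'I_m) : V :=
  (if t.2 == 0 :> nat then Ordinal (lt_o t.1) else Ordinal (lt_e t.1),
   Ordinal (lt_c t.2)).
have f_inj : injective f.
  move=> [a b] [a' b'] [] /(congr1 val) /= e1 e2.
  have eb : b = b' by apply: val_inj => /=; lia.
  subst b'; congr (_, _); apply: val_inj => /=.
  by move: e1; case: ifP => /= _; lia.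
have <- : #|f @: [set: 'I_n * 'I_m]| = (m * n)%N.
  by rewrite card_imset // cardsT card_prod !card_ord mulnC.
apply/subset_leq_card/subsetP=> _ /imsetP[[a b] _ ->];
  rewrite inE /marked /f /=.
by case: (b =P 0%N :> nat) => [b0|b0] /=; rewrite ?b0; case: ifP; lia.
Qed.

Lemma chiE (x y : int) : 0 <= x < p%:Z -> chi x y ->
  (odd `|x| /\ (q%:Z %| y)%Z) \/
  [/\ ~~ odd `|x|, (y %% 2)%Z = 0 & ~~ (q%:Z %| y)%Z].
Proof.
move=> xp; rewrite /chi /marked.
have [e1 e2] := cover_torusE s p_gt1 q_gt2 x y.
rewrite divz_small ?mulr0 ?addr0 in e2; last by rewrite /p in xp *; lia.
rewrite modz_small // in e1.
have -> : nat_of_ord (cov x y).1 = `|x|%N by rewrite -[in RHS]e1.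
have dvd : (q%:Z %| y)%Z = ((cov x y).2 == 0 :> nat).
  rewrite -eqz_nat [X in X == _]e2.
  by apply/idP/eqP => [/dvdz_mod0P|/dvdz_mod0P].
rewrite dvd; case: ifP => ox; [by left | move=> /andP[oj j0]; right].
split=> //.
have ey : y = (y %/ q)%Z * q + (nat_of_ord (cov x y).2)%:Z
  by rewrite e2 -divz_eq.
by move: (y %/ q)%Z (nat_of_ord _) ey oj => l j -> oj; rewrite /q; lia.
Qed.

Lemma chi_residue x y : 0 <= x < p%:Z -> chi x y ->
  mark_residue q x y /\ ((x %% 2)%Z = 1 -> (q%:Z %| y)%Z).
Proof.
move=> xp /(chiE xp) [[ox dy]|[ox y2 ny]]; split.
- left; split; first by clear -ox xp; lia.
  split; last exact: dvdz_lt_eq0.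
  by case/dvdzP: dy => l ->; rewrite /q; lia.
- by [].
- right; split; first by clear -ox xp; lia.
  by split=> //; split=> ey; rewrite ey ?dvdz0 ?dvdzz in ny.
by clear -ox xp; lia.
Qed.

Lemma chi_up x y : chi (x + p%:Z) y = chi x (y + s%:Z).
Proof. by rewrite /chi /cov cover_torus_glue. Qed.

Lemma chi_down x y : chi (x - p%:Z) y = chi x (y - s%:Z).
Proof. by rewrite -[in LHS](subrK s%:Z y) -chi_up subrK. Qed.

(** Two unit steps from the board stay in this range of rows. Divisibility by [q] is recorded only
    below row 0, where it identifies the marked vertex of the last row. *)
Lemma chi_window u v : - p%:Z <= u < p%:Z + p%:Z -> chi u v ->
  [\/ (0 <= u < p%:Z) /\ mark_residue q u v,
      (0 <= u - p%:Z < p%:Z) /\ mark_residue q (u - p%:Z) (v + s%:Z) |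
      (0 <= u + p%:Z < p%:Z) /\ (mark_residue q (u + p%:Z) (v - s%:Z) /\
        (((u + p%:Z) %% 2)%Z = 1 -> (q%:Z %| v - s%:Z)%Z))].
Proof.
move=> ub c.
have : [\/ 0 <= u < p%:Z, 0 <= u - p%:Z < p%:Z | 0 <= u + p%:Z < p%:Z].
  clear -ub p_gt1; clearbody p.
  case: (ltP u 0) => ?; first by constructor 3; lia.
  case: (ltP u p) => ?; first by constructor 1; lia.
  by constructor 2; lia.
case=> xr.
- by constructor 1; split=> //; exact: (chi_residue xr c).1.
- constructor 2; split=> //; rewrite -[u](subrK p%:Z) chi_up in c.
  exact: (chi_residue xr c).1.
constructor 3; split=> //; rewrite -[u](addrK p%:Z) chi_down in c.
exact: chi_residue xr c.
Qed.

Lemma unit_step_bound a b : unit_step a b -> (-1 <= a <= 1) /\ (-1 <= b <= 1).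
Proof. by rewrite /unit_step; lia. Qed.

Lemma unit_stepN a b : unit_step a b -> unit_step (- a) (- b).
Proof. by rewrite /unit_step; lia. Qed.

Lemma chi_step (x y a b a' b' : int) :
    0 <= x < p%:Z -> 0 <= y < q%:Z -> chi x y ->
    unit_step a b -> unit_step a' b' -> ~ (a' = - a /\ b' = - b) ->
    chi (x + a + a') (y + b + b') ->
  [\/ [/\ a' = a, b' = b, 0 <= x + 2 * a < p%:Z, 0 <= y + 2 * b < q%:Z
        & (x %% 2)%Z = 1 -> b = 0],
      [/\ x = 0, a + a' = -1 & (q%:Z %| y + b + b' - s%:Z)%Z] |
      x = p%:Z - 1 /\ a + a' = 1].
Proof.
move=> xp yq c us us' nopp c'.
have [Fx _] := chi_residue xp c.
apply: (mark_residue_step (S := s)) => //; try by rewrite /p /q /s; lia.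
apply: chi_window c'.
have [ab _] := unit_step_bound us; have [ab' _] := unit_step_bound us'.
by have := p_gt1; clearbody p; clear -xp ab ab'; lia.
Qed.

(** A horizontal step changes the parity of the column, and so does a vertical step through the seam
    because [s] is odd. Any other vertical step changes the parity of the row, and rows of opposite
    parity have no marked column in common. *)
Lemma chi_independent (x y a b : int) :
    0 <= x < p%:Z -> 0 <= y < q%:Z -> chi x y -> unit_step a b ->
  ~~ chi (x + a) (y + b).
Proof.
move=> xp yq c us; apply/negP => c'.
have [F1 _] := chi_residue xp c.
have ab := unit_step_bound us.
have [] := chi_window _ c'.
- by have := p_gt1; clearbody p; clear -xp ab; lia.
all: move=> -[xr].
all: rewrite /mark_residue in F1 *.
all: have := s_bounds; have : (q %% 2)%Z = 0 by rewrite /q; lia.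
all: have : (p %% 2)%Z = 0 by rewrite /p; lia.
all: have : (s %% 2)%Z = 1 by rewrite /s; lia.
all: move: xp yq F1 xr; clear -us; clearbody p q s.
all: by case: us => -[-> [] ->]; lia.
Qed.

(** * Emptiness of closed sets of marked vertices *)

Section NoCycle.

Variables dx dy : int -> int -> int.
Hypothesis d_unit : forall x y, unit_step (dx x y) (dy x y).
Hypothesis d_oppx : forall x y, dx (x + dx x y) (y + dy x y) = - dx x y.
Hypothesis d_oppy : forall x y, dy (x + dx x y) (y + dy x y) = - dy x y.

(** [cv] stands for the covering preceded by a translation of the lattice; [dx] and [dy] are read in
    the translated coordinates, in which the marking is in standard position. [A_next] lifts the
    condition excluded in [forcing_number_independent]. *)
Variables (cv : int -> int -> V) (A : {set V}).
Hypothesis cv_down : forall x y, cv (x - p%:Z) y = cv x (y - s%:Z).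
Hypothesis cv_round : forall x y l, cv x (y + l * q%:Z) = cv x y.
Hypothesis cv_box : forall v, exists x y : int,
  [/\ 0 <= x < p%:Z, 0 <= y < q%:Z & cv x y = v].
Hypothesis A_chi : forall x y, cv x y \in A -> chi x y.
Hypothesis A_next : forall x y, cv x y \in A -> exists a b,
  [/\ unit_step a b, ~ (a = - dx x y /\ b = - dy x y)
    & cv (x + dx x y + a) (y + dy x y + b) \in A].

(** With [z] the marked vertex [(p - 1, 0)] and [t] the point [(x, y)], the cases are
    [t' = t + 2 d(t)], [t' = z] reached through the seam from row 0, and [t = z] left through the
    seam. *)
Lemma closed_step x y : 0 <= x < p%:Z -> 0 <= y < q%:Z -> cv x y \in A ->
  [\/ [/\ 0 <= x + 2 * dx x y < p%:Z, 0 <= y + 2 * dy x y < q%:Z,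
          (x %% 2)%Z = 1 -> dy x y = 0
        & cv (x + 2 * dx x y) (y + 2 * dy x y) \in A],
      [/\ x = 0, cv (p%:Z - 1) 0 \in A
        & dx x y = 0 -> (q%:Z %| y + dy x y - s%:Z)%Z] |
      [/\ x = p%:Z - 1, dx x y <> -1
        & dx x y = 0 -> cv p (dy x y) \in A]].
Proof.
move=> xp yq xyA; have [a [b [us nopp nA]]] := A_next xyA.
have c := A_chi xyA.
case: (chi_step xp yq c (d_unit x y) us nopp (A_chi nA)).
- case=> ea eb xr yr y0; constructor 1; split=> //.
  by rewrite !mulrDl !mul1r !addrA -{2}ea -{2}eb.
- case=> x0 ab dvd; constructor 2; split=> //.
    have /dvdzP[l el] := dvd.
    suff <- : cv (x + dx x y + a) (y + dy x y + b) = cv (p%:Z - 1) 0 by [].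
    rewrite -(cv_round _ 0 l) add0r -el -cv_down -addrA ab x0 add0r.
    by congr (cv _ _); lia.
  by move=> d0; have b0 : b = 0; [rewrite /unit_step in us;
    lia | rewrite b0 addr0 in dvd].
case=> ex ab; constructor 3; split=> //.
  by have := unit_step_bound us; lia.
move=> d0; have b0 : b = 0 by rewrite /unit_step in us; lia.
have y0 : y = 0.
  have [] := chi_residue xp c; rewrite /mark_residue => Fx _.
  have pe : (p %% 2)%Z = 0 by rewrite /p; lia.
  by clear -Fx pe yq ex; clearbody p q; lia.
suff <- : cv (x + dx x y + a) (y + dy x y + b) = cv p (dy x y) by [].
by congr (cv _ _); [clear -ab ex; lia | rewrite b0 addr0 {1}y0 add0r].
Qed.

(** Jumps preserve the parity of the row, so the two parities can be treated separately. The points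
    of the board over [A] in such rows are finite in number and all in even columns, as
    [no_closed_set] requires. *)
Lemma closed_part_empty (i : int) :
    (forall x y, 0 <= x < p%:Z -> 0 <= y < q%:Z -> (x %% 2 = i %% 2)%Z ->
       cv x y \in A ->
       [/\ 0 <= x + 2 * dx x y < p%:Z, 0 <= y + 2 * dy x y < q%:Z
         & cv (x + 2 * dx x y) (y + 2 * dy x y) \in A]) ->
  forall x y, 0 <= x < p%:Z -> 0 <= y < q%:Z -> (x %% 2 = i %% 2)%Z ->
    cv x y \notin A.
Proof.
move=> cl x y xp yq xi; apply/negP=> xyA.
pose box := [seq (k%:Z, l%:Z) | k <- iota 0 p, l <- iota 0 q].
pose S := [seq t <- box | (t.1 %% 2 == i %% 2)%Z && (cv t.1 t.2 \in A)].
have memS u v : reflect [/\ 0 <= u < p%:Z, 0 <= v < q%:Z, (u %% 2 = i %% 2)%Z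
  & cv u v \in A]
    ((u, v) \in S).
  rewrite mem_filter /=; apply: (iffP andP).
    move=> [/andP[/eqP ui uA] /allpairsP[[k l] /= []]].
    rewrite !mem_iota => kp lq [ek el]; split=> //; clear -kp lq ek el;
      clearbody p q; lia.
  move=> [up vq ui uA]; rewrite ui eqxx uA; split=> //.
  apply/allpairsP; exists (`|u|%N, `|v|%N); rewrite !mem_iota /=.
  by clear -up vq; clearbody p q; split; [lia | lia | congr (_, _); lia].
apply: (@no_closed_set dx dy d_unit d_oppx d_oppy S i 0).
- have : (x, y) \in S by apply/memS; split.
  by case: (S).
- move=> [u v] /memS[up vq ui uA]; split=> //.
  by have [] := chi_residue up (A_chi uA); rewrite /mark_residue /=; lia.
move=> [u v] /memS[up vq ui uA]; apply/memS.
have [up' vq' uA'] := cl _ _ up vq ui uA; split=> //=.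
by clear -ui; lia.
Qed.

(** An edge from [z = (p - 1, 0)] down to row [p - 2] rules out leaving through the seam, so the
    part of [A] in odd rows is closed under jumps, hence empty. Then [z] is not in [A], and the even
    rows are closed as well. *)
Lemma closed_empty_vertical : dx (p%:Z - 1) 0 = -1 -> A = set0.
Proof.
move=> down.
have no1 : forall x y, 0 <= x < p%:Z -> 0 <= y < q%:Z -> (x %% 2 = 1 %% 2)%Z ->
    cv x y \notin A.
  apply: closed_part_empty => x y xp yq x1 xyA.
  have y0 : y = 0.
    have [] := chi_residue xp (A_chi xyA); rewrite /mark_residue => Fx _.
    by clear -Fx x1 yq; clearbody q; lia.
  rewrite {}y0 in xyA yq *.
  case: (closed_step xp yq xyA) => [[]|[x0]|[ex]] //.
  - by rewrite x0 in x1.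
  - by rewrite ex.
have no0 : forall x y, 0 <= x < p%:Z -> 0 <= y < q%:Z -> (x %% 2 = 0 %% 2)%Z ->
    cv x y \notin A.
  apply: closed_part_empty => x y xp yq x0 xyA.
  have pe : (p %% 2)%Z = 0 by rewrite /p; lia.
  case: (closed_step xp yq xyA) => [[]|[_ glue]|[ex]] //.
  - exfalso; apply: (negP (no1 _ _ _ _ _) glue); first by clear -xp;
    clearbody p; lia.
      by clear -yq; clearbody q; lia.
    by clear -pe; clearbody p; lia.
  - by exfalso; clear -ex x0 pe; clearbody p; lia.
apply/setP=> v; rewrite inE; apply/negbTE.
have [x [y [xp yq <-]]] := cv_box v.
have [x2|x2] : (x %% 2 = 0 %% 2)%Z \/ (x %% 2 = 1 %% 2)%Z by clear; lia.
  exact: no0.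
exact: no1.
Qed.

(** The even rows come first: if a vertex of [A] there is followed by [z = (p - 1, 0)], its jump is
    in [A] too. In odd rows only column 0 is marked, and from it a horizontal edge leads on only
    through the seam, into row 0, which is already empty. *)
Lemma closed_empty_horizontal :
  (forall x y, dx x y = 0) -> dy p 0 = - dy (p%:Z - 1) 0 -> 
  (forall x y x' y', cv x y = cv x' y' -> dy x y = dy x' y') ->
  A = set0.
Proof.
move=> d0 anti dy_cv.
have dyn0 x y : dy x y <> 0 by have := d_unit x y; rewrite /unit_step d0; lia.
have pe : (p %% 2)%Z = 0 by rewrite /p; lia.
have se : (s %% 2)%Z = 1 by rewrite /s; lia.
have qe : (q %% 2)%Z = 0 by rewrite /q; lia.
have p2 := p_gt1; have q3 := q_gt2.
have pr : 0 <= p%:Z - 1 < p%:Z by clear -p2; clearbody p; lia.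
have q0 : 0 <= (0 : int) < q%:Z by clear -q3; clearbody q; lia.
have cv_up y : cv p y = cv 0 (y + s%:Z).
  by have := cv_down p (y + s%:Z); rewrite subrr addrK.
have last : cv (p%:Z - 1) 0 \in A -> cv p (dy (p%:Z - 1) 0) \in A.
  move=> lA; case: (closed_step pr q0 lA) => [[_ _ y0 _]|[e _ _]|[_ _ lA']].
  - by case: (dyn0 _ _ (y0 _)); clear -pe; clearbody p; lia.
  - by exfalso; clear -e p2; clearbody p; lia.
  - exact: lA'.
have no0 : forall x y, 0 <= x < p%:Z -> 0 <= y < q%:Z -> (x %% 2 = 0 %% 2)%Z ->
    cv x y \notin A.
  apply: closed_part_empty => x y xp yq x0 xyA.
  case: (closed_step xp yq xyA) => [[]|[ex /last lA]|[ex]] //; last first.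
    by exfalso; clear -ex x0 pe; clearbody p; lia.
  (* The partner of [(0, y)] is, up to a period, the neighbour [(p, 0)] of [z]. By [anti], [z] and
     [(0, y)] are matched in the same direction, so the successor of [z] is
     [(0, y + 2 * dy 0 y)]. *)
  rewrite {}ex in xp x0 xyA * => /(_ (d0 0 y))/dvdzP[l el].
  have eds : dy p 0 = - dy 0 y.
    have -> : dy p 0 = dy 0 (y + dy 0 y).
      apply: dy_cv; rewrite cv_up add0r -(cv_round _ _ l); congr (cv _ _).
      by rewrite -el addrC subrK.
    by have := d_oppy 0 y; rewrite d0 addr0.
  have ed : dy (p%:Z - 1) 0 = dy 0 y by clear -eds anti; lia.
  have A2 : cv (0 + 2 * dx 0 y) (y + 2 * dy 0 y) \in A.
    rewrite d0 mulr0 addr0.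
    suff <- : cv p (dy (p%:Z - 1) 0) = cv 0 (y + 2 * dy 0 y) by [].
    rewrite cv_up ed -(cv_round _ _ l); congr (cv _ _).
    by rewrite -el addrC addrA addrAC subrK -addrA mulrDl mul1r.
  have c := A_chi xyA; have c2 := A_chi A2.
  rewrite d0 mulr0 addr0 in A2 c2 *; split=> //.
  have [F1 _] := chi_residue xp c; have [F2 _] := chi_residue xp c2.
  have [_ db] := unit_step_bound (d_unit 0 y).
  rewrite /mark_residue in F1 F2.
  move: (dy 0 y) db F2 => d db F2.
  by clear -F1 F2 yq db qe; clearbody q; lia.
have no0' y : cv 0 y \notin A.
  rewrite (divz_eq y q) addrC cv_round; apply: no0 => //.
    by clear -p2; clearbody p; lia.
  by rewrite modz_ge0 ?ltz_pmod //; clear -q3; clearbody q; lia.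
apply/setP=> v; rewrite inE; apply/negbTE/negP.
have [x [y [xp yq <-]]] := cv_box v => xyA.
have [x2|x2] : (x %% 2 = 0 %% 2)%Z \/ (x %% 2 = 1 %% 2)%Z by clear; lia.
  by have := no0 x y xp yq x2; rewrite xyA.
case: (closed_step xp yq xyA) => [[_ _ y0 _]|[ex _ _]|[_ _ lA]].
- exact: dyn0 (y0 x2).
- by rewrite ex in x2.
by move: (lA (d0 x y)); rewrite cv_up; apply/negP.
Qed.

End NoCycle.

(* Translating by [(x0, y0)] puts a downward edge, or a pair of misaligned rows,
   next to the seam. *)
Lemma forcing_number_le_based mu (dx dy : int -> int -> int) (x0 y0 : int) :
    is_mate (torus p q s) mu ->
    (forall x y, unit_step (dx x y) (dy x y)) ->
    (forall x y, mu (cov x y) = cov (x + dx x y) (y + dy x y)) ->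
    (forall x y, dx (x + dx x y) (y + dy x y) = - dx x y) ->
    (forall x y, dy (x + dx x y) (y + dy x y) = - dy x y) ->
    (forall x y x' y', cov x y = cov x' y' -> dy x y = dy x' y') ->
    dx (x0 + (p%:Z - 1)) y0 = -1 \/
    (forall x y, dx x y = 0) /\ dy (x0 + p%:Z) y0 = - dy (x0 + (p%:Z - 1)) y0 ->
  (forcing_number (torus p q s) (mate_matching mu) <= m * n)%N.
Proof.
move=> mP d_unit d_mu d_oppx d_oppy d_cov base.
have e_sym := @torus_sym p q s.
have e_irr : irreflexive (torus p q s) by apply: torus_irrefl => //;
  exact: ltnW.
pose cv x y := cov (x0 + x) (y0 + y).
pose sh (v : V) : V := cov (v.1%:Z - x0) (v.2%:Z - y0).
have sh_cv x y : sh (cv x y) = cov x y.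
  rewrite /sh /cv; set v := cov (x0 + x) _.
  have ev : cov v.1 v.2 = cov (x0 + x) (y0 + y) by exact: cover_torus_val.
  transitivity (cov (x0 + x - x0) (y0 + y - y0));
    first exact: cover_torus_shift ev.
  by congr (cov _ _); rewrite addrC addKr.
have cv_sh v : cv (sh v).1 (sh v).2 = v.
  have ev : cov (sh v).1 (sh v).2 = cov (v.1%:Z - x0) (v.2%:Z - y0)
    by exact: cover_torus_val.
  rewrite /cv ![_ + _%:Z]addrC -[RHS](cover_torus_val s p_gt1 q_gt2).
  by rewrite [LHS](cover_torus_shift x0 y0 ev) !subrK.
pose X := [set v | marked (sh v)].
have cardX : #|X| = #|[set v | marked v]|.
  rewrite -[RHS](card_preimset (f := sh)); first by apply: eq_card => v;
    rewrite /X !inE.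
  exact: can_inj (fun v => cv (nat_of_ord v.1) (nat_of_ord v.2)) cv_sh.
have X_chi x y : (cv x y \in X) = chi x y by rewrite /X inE sh_cv.
have cv_box v : exists x y :
  int, [/\ 0 <= x < p%:Z, 0 <= y < q%:Z & cv x y = v].
  by exists (sh v).1, (sh v).2; rewrite !ltz_nat !ltn_ord cv_sh.
have cv_nbr x y v : torus p q s (cv x y) v ->
    exists a b, unit_step a b /\ v = cv (x + a) (y + b).
  by case/torus_cover_nbr => a [b [us ->]]; exists a, b; rewrite /cv !addrA.
have X_ind : {in X &, forall u v, ~~ torus p q s u v}.
  move=> u v; have [x [y [xp yq <-]]] := cv_box u => uX vX; apply/negP => uv.
  have [a [b [us ev]]] := cv_nbr _ _ _ uv; rewrite {}ev !X_chi in uX vX *.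
  by move: vX; apply/negP; exact: chi_independent xp yq uX us.
have cardM := card_perfect_matching e_irr (perfect_mate_matching mP).
suff noA (A : {set V}) : A \subset X -> A != set0 ->
    ~ {in A, forall t, exists2 t', t' \in A
      & (t' != t) && torus p q s (mu t) t'}.
  have := forcing_number_independent e_sym e_irr mP X_ind noA.
  have := card_marked; rewrite -cardX.
  by move: cardM; rewrite card_prod !card_ord /p /q; nia.
move=> sAX A0 clA; move: A0; apply/negP; rewrite negbK; apply/eqP.
pose ax x y := dx (x0 + x) (y0 + y); pose ay x y := dy (x0 + x) (y0 + y).
have A_chi x y : cv x y \in A -> chi x y by rewrite -X_chi;
  exact: (subsetP sAX).
have a_unit x y : unit_step (ax x y) (ay x y) by exact: d_unit.
have a_oppx x y : ax (x + ax x y) (y + ay x y) = - ax x y.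
  by rewrite {1}/ax !addrA; exact: d_oppx.
have a_oppy x y : ay (x + ax x y) (y + ay x y) = - ay x y.
  by rewrite {1}/ay !addrA; exact: d_oppy.
have cv_down x y : cv (x - p%:Z) y = cv x (y - s%:Z).
  rewrite /cv /cov !addrA -[y0 + y in LHS](subrK s%:Z)
    -cover_torus_glue subrK //.
have cv_round x y l : cv x (y + l * q%:Z) = cv x y.
  by rewrite /cv addrA /cov cover_torus_round.
have A_next x y : cv x y \in A -> exists a b,
  [/\ unit_step a b, ~ (a = - ax x y /\ b = - ay x y)
    & cv (x + ax x y + a) (y + ay x y + b) \in A].
  move=> xyA; have [t' t'A /andP[neq]] := clA _ xyA.
  have -> : mu (cv x y) = cv (x + ax x y) (y + ay x y)
    by rewrite /cv d_mu !addrA.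
  case/cv_nbr => a [b [us et]]; exists a, b; rewrite -et; split=> // -[ea eb].
  by move/eqP: neq; apply; rewrite et ea eb !addrK.
case: base => [down|[d0 anti]].
  apply: (closed_empty_vertical a_unit a_oppx a_oppy cv_down cv_round cv_box
    A_chi A_next).
  by rewrite /ax addr0.
apply: (closed_empty_horizontal a_unit a_oppx a_oppy cv_down cv_round cv_box
  A_chi A_next).
- by move=> x y; exact: d0.
- by rewrite /ay !addr0.
by move=> x y x' y'; exact: d_cov.
Qed.

(** If [M] has a vertical edge, its end with [dx = -1] serves as base. Otherwise directions
    alternate along each row; if consecutive rows always agreed, [dy p 0] would equal [dy 0 0], but
    it equals [dy 0 s], of opposite sign since [s] is odd. *)
Lemma forcing_number_torus_le M : perfect_matching (torus p q s) M ->
  (forcing_number (torus p q s) M <= m * n)%N.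
Proof.
have e_sym := @torus_sym p q s.
have e_irr : irreflexive (torus p q s) by apply: torus_irrefl => //;
  exact: ltnW.
move=> pM; have [mu mP ->] := perfect_matching_mate e_sym e_irr pM.
have [dx [dy d]] := cover_torus_mate p_gt1 q_gt2 mP.
have d_unit x y := (d x y).1; have d_mu x y := (d x y).2.
(* Applying [mu] twice returns to the start, and distinct unit steps from one point reach distinct
   vertices, so the lift is a matching of the lattice. *)
have d_opp x y : dx (x + dx x y) (y + dy x y) = - dx x y /\
                 dy (x + dx x y) (y + dy x y) = - dy x y.
  apply: (cover_torus_nbr_inj (p_gt1 := p_gt1) (q_gt2 := q_gt2) s_bounds
    (x := x + dx x y) (y := y + dy x y) (d_unit _ _) (unit_stepN (d_unit x y))).
  by rewrite -d_mu -d_mu (proj1 mP) !addrK.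
have d_cov x y x' y' :
  cov x y = cov x' y' -> dx x y = dx x' y' /\ dy x y = dy x' y'.
  move=> e; apply: (cover_torus_nbr_inj (p_gt1 := p_gt1) (q_gt2 :=
    q_gt2) s_bounds
    (x := x) (y := y) (d_unit _ _) (d_unit _ _)).
  by rewrite -d_mu [RHS](cover_torus_shift _ _ e) -d_mu; congr mu.
have le_based x0 y0 := @forcing_number_le_based mu dx dy x0 y0 mP d_unit d_mu
  (fun x y => (d_opp x y).1) (fun x y => (d_opp x y).2)
  (fun x y x' y' e => (d_cov x y x' y' e).2).
have [/existsP[v dv]|] := boolP [exists v : V, dx v.1 v.2 != 0].
  have [x [y dxy]] : exists x y, dx x y = -1.
    have [e|e] : dx v.1 v.2 = -1 \/ dx v.1 v.2 = 1.
      case: (d_unit v.1 v.2) dv => -[]; first by move=> ->; rewrite eqxx.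
      by move=> _ [] ->; [right | left].
      by exists v.1, v.2.
    exists (v.1%:Z + dx v.1 v.2), (v.2%:Z + dy v.1 v.2).
    by rewrite (d_opp _ _).1 e.
  by apply: (le_based (x - (p%:Z - 1)) y); left; rewrite subrK.
rewrite negb_exists => /forallP no_vert.
have d0 x y : dx x y = 0.
  have [-> _] := d_cov _ _ _ _ (esym (cover_torus_val s p_gt1 q_gt2 (cov x y))).
  by apply/eqP; move: (no_vert (cov x y)); rewrite negbK.
have dy_val x y : dy x y = 1 \/ dy x y = -1.
  by case: (d_unit x y) => -[] //; rewrite d0 => _ [].
have dy_right x y : dy x (y + 1) = - dy x y.
  have [e|e] := dy_val x y.
    by have [_] := d_opp x y; rewrite d0 addr0 e.
  have [e'|e'] := dy_val x (y + 1); first by rewrite e e'.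
  by have [_] := d_opp x (y + 1); rewrite d0 addr0 e' addrK e; lia.
have dy_shift x (k : nat) : dy x k%:Z = (-1) ^+ k * dy x 0.
  elim: k => [|k IH]; first by rewrite expr0 mul1r.
  by rewrite -addn1 PoszD dy_right IH exprD expr1 mulrN1 mulNr.
have [/existsP[x /eqP anti]|] :=
    boolP [exists x : 'I_p, dy (x%:Z + 1) 0 == - dy x 0].
  apply: (le_based (x%:Z - (p%:Z - 1)) 0); right; split=> //.
  rewrite subrK -anti; congr (dy _ _); lia.
rewrite negb_exists => /forallP no_anti; exfalso.
have const (k : nat) : (k <= p)%N -> dy k 0 = dy 0 0.
  elim: k => [//|k IH] kp; rewrite -[RHS](IH (ltnW kp)).
  have := no_anti (Ordinal kp); rewrite -addn1 PoszD.
  by case: (dy_val k 0) => ->; case: (dy_val (k%:Z + 1) 0) => ->.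
have := const p (leqnn p).
have [_ ->] : dx p 0 = dx 0 s /\ dy p 0 = dy 0 s.
  by apply: d_cov; rewrite /cov -[p%:Z]add0r cover_torus_glue add0r.
rewrite dy_shift -signr_odd (_ : odd s) ?expr1; last by rewrite /s; lia.
by case: (dy_val 0 0) => ->.
Qed.

End UpperBound.

Local Close Scope ring_scope.

Theorem theorem4p3 (n m r : nat) (hn : 1 <= n) (hm : 2 <= m) (hr : 1 <= r <= m) :
  max_forcing_number (torus (2 * n) (2 * m) (2 * r - 1)) = m * n.
Proof.
apply/eqP; rewrite eqn_leq torus_max_forcing_ge // andbT.
by apply/bigmax_leqP => M; exact: forcing_number_torus_le.
Qed.
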